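(* In every rhombus the two diagonals intersect at their midpoints and are mutually perpendicular. That is, if $ABDC$ is a rhombus with diagonals $BC$ and $AD$, then the midpoint of $BC$ is also the midpoint of $AD$, and the line through $B, C$ is perpendicular to the line through $A, D$.
   Context: Setting. A plane consists of a set of points, a family of lines (sets of points), a (strict) betweenness relation, and a relation $\cong$ (congruence) on segments, with the following assumptions. Incidence: two distinct points lie on exactly one line; every line has at least two points; there exist three non-collinear points. Order: the points of each line carry a pair of mutually opposite total orders, and $C$ lies between $A$ and $B$ iff it lies strictly between them on their common line for these orders. For $A \ne B$, the segment $AB = BA$ consists of $A$, $B$ and all points between them; between any two distinct points there is another point; every segment can be extended beyond either end. A point $O$ of a line divides the line into two opposite rays based at $O$ having only $O$ in common; $\overrightarrow{OA}$ denotes the ray based at $O$ containing $A\neq O$. Plane separation: each line $l$ partitions the points not on $l$ into two nonempty classes (the sides of $l$); each side is convex (contains the segment $AB$ whenever it contains $A$ and $B$), and a segment with ends on different sides of $l$ meets $l$. Congruence: $\cong$ is an equivalence relation on (undirected) segments. For every segment $AB$ and every ray based at a point $O$ there is a unique point $X \neq O$ on that ray with $OX \cong AB$. Addition and subtraction of segments: let $B$ lie between $A$ and $C$, and $B'$ between $A'$ and $C'$. If two of $AB \cong A'B'$, $BC \cong B'C'$, $AC \cong A'C'$ hold, so does the third. Every segment $BC$ has a midpoint (a point $M$ between $B$ and $C$ with $MB\cong MC$). Axiom T: if $A,B,C$ are non-collinear points and $A'B' \cong AB$, where $A'$ and $B'$ lie on a line $l$, then on either side of $l$ there is a point $C'$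 with $A'C' \cong AC$ and $B'C' \cong BC$. Angles: an angle is a pair of rays, not lying on a common line, with the same base point (its vertex); $\angle XMY$ has rays $\overrightarrow{MX}$, $\overrightarrow{MY}$. If $A,B,C$ are non-collinear with $AB \cong AC$ and $M$ is the midpoint of $BC$, then $\angle AMB$ and $\angle AMC$ are called paired right angles at $M$. A right angle is an angle that is a member of some such pair. Axiom R1: if $\angle BAC$ and $\angle EDF$ are right angles with $AB \cong DE$ and $AC \cong DF$, then $BC \cong EF$. Axiom R2: at most one angle of a triangle (three non-collinear points) is a right angle. Perpendicular lines: two distinct lines meeting at $M$ form four angles at $M$; the lines are perpendicular if any two consecutive ones of these four angles are paired right angles. Rhombus: a quadrilateral $ABDC$ where $A, B, C$ are non-collinear, $A$ and $D$ lie on different sides of the line through $B$ and $C$, and $AB \cong BD \cong DC \cong CA$. Its diagonals are $BC$ and $AD$. *)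

(* Defs.v *)
From mathcomp Require Import all_boot.
From mathcomp Require Import boolp classical_sets.

Set Implicit Arguments.
Unset Strict Implicit.
Unset Printing Implicit Defensive.

Local Open Scope classical_set_scope.

(* [between A C B] reads "C lies (strictly) between A and B".  Congruence is a
   relation on segments, which are sets of points; [cong] is only meaningful on
   such sets (see [cong_segments] below). *)
Record geometry := Geometry {
  point :> Type;
  line : set (set point);
  between : point -> point -> point -> Prop;
  cong : set point -> set point -> Prop
}.

Definition collinear (G : geometry) (A B C : G) : Prop :=
  exists l : set G, [/\ line l, l A, l B & l C].

(* Used for A <> B only: then it is the unique line containing A and B. *)
Definition line_through (G : geometry) (A B : G) : set G :=
  [set X | exists l : set G, [/\ line l, l A, l B & l X]].

(* [le] is one of the two opposite total orders of the line l; the values of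
   [le] outside l are irrelevant.  The disjunction accounts for [le] and its
   opposite. *)
Definition line_order (G : geometry) (l : set G) (le : G -> G -> Prop) : Prop :=
  [/\ forall A, l A -> le A A,
      forall A B, l A -> l B -> le A B -> le B A -> A = B,
      forall A B C, l A -> l B -> l C -> le A B -> le B C -> le A C,
      total_on l le
    & forall A B C, l A -> l B ->
        (between A C B <->
         [/\ l C, C <> A, C <> B
           & (le A C /\ le C B) \/ (le B C /\ le C A)])].

Definition seg (G : geometry) (A B : G) : set G :=
  [set X | [\/ X = A, X = B | between A X B]].

Definition is_segment (G : geometry) (S : set G) : Prop :=
  exists A B : G, A <> B /\ S = seg A B.

(* r and r' are the two rays into which the point O divides the line l. *)
Definition opposite_rays (G : geometry) (l : set G) (O : G) (r r' : set G)
  : Prop :=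
  [/\ line l, l O
    & exists le, [/\ line_order l le,
        r = [set X | l X /\ le O X] & r' = [set X | l X /\ le X O]]].

Definition is_ray (G : geometry) (O : G) (r : set G) : Prop :=
  exists (l : set G) (r' : set G), opposite_rays l O r r'.

(* Used for A <> O only: then it is the unique ray based at O containing A. *)
Definition ray (G : geometry) (O A : G) : set G :=
  [set X | exists r : set G, [/\ is_ray O r, r A & r X]].

Definition convex (G : geometry) (S : set G) : Prop :=
  forall A B : G, S A -> S B -> seg A B `<=` S.

(* S and S' are the two sides of l; the conditions determine them up to
   exchange, since X and Y lie on different sides iff seg X Y meets l. *)
Definition sides (G : geometry) (l S S' : set G) : Prop :=
  [/\ S !=set0 /\ S' !=set0,
      S `&` S' = set0,
      S `|` S' = ~` l,
      convex S /\ convex S'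
    & forall X Y : G, S X -> S' Y -> seg X Y `&` l !=set0].

Definition is_side (G : geometry) (l S : set G) : Prop :=
  exists S' : set G, sides l S S'.

Definition on_different_sides (G : geometry) (l : set G) (A D : G) : Prop :=
  exists S S' : set G, [/\ sides l S S', S A & S' D].

Definition is_midpoint (G : geometry) (B C M : G) : Prop :=
  between B M C /\ cong (seg M B) (seg M C).

(* An angle is an unordered pair of rays with a common base point.  The
   requirement that these do not lie on a common line is a consequence of the
   conditions imposed wherever [angle] is used. *)
Definition angle (G : geometry) (X M Y : G) : set (set G) :=
  [set ray M X; ray M Y].

Definition paired_right_angles (G : geometry) (M : G) (a b : set (set G))
  : Prop :=
  exists A B C : G,
    [/\ ~ collinear A B C, cong (seg A B) (seg A C), is_midpoint B C M,
        a = angle A M B & b = angle A M C].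

Definition right_angle (G : geometry) (a : set (set G)) : Prop :=
  exists (M : G) (b : set (set G)),
    paired_right_angles M a b \/ paired_right_angles M b a.

(* The four angles formed by l and m are, in cyclic order, those with sides
   r s, s r', r' s' and s' r. *)
Definition perpendicular (G : geometry) (l m : set G) : Prop :=
  [/\ line l, line m, l <> m
    & exists M : G, [/\ l M, m M
      & forall r r' s s' : set G,
          opposite_rays l M r r' -> opposite_rays m M s s' ->
          [/\ paired_right_angles M [set r; s] [set s; r'],
              paired_right_angles M [set s; r'] [set r'; s'],
              paired_right_angles M [set r'; s'] [set s'; r]
            & paired_right_angles M [set s'; r] [set r; s]]]].

(* The vertices are listed in cyclic order: the diagonals are BC and AD. *)
Definition rhombus (G : geometry) (A B D C : G) : Prop :=
  [/\ ~ collinear A B C,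
      on_different_sides (line_through B C) A D,
      cong (seg A B) (seg B D),
      cong (seg B D) (seg D C)
    & cong (seg D C) (seg C A)].

Record plane_axioms (G : geometry) : Prop := PlaneAxioms {
  line_unique : forall A B : G, A <> B ->
    exists! l : set G, [/\ line l, l A & l B];
  line_two_points : forall l : set G, line l ->
    exists A B : G, [/\ A <> B, l A & l B];
  noncollinear_points : exists A B C : G, ~ collinear A B C;

  line_ordered : forall l : set G, line l -> exists le, line_order l le;
  between_dense : forall A B : G, A <> B -> exists C, between A C B;
  (* extension beyond B; beyond A by exchanging A and B *)
  between_extend : forall A B : G, A <> B -> exists C, between A B C;

  plane_separation : forall l : set G, line l -> exists S S', sides l S S';

  cong_segments : forall S T : set G, cong S T -> is_segment S /\ is_segment T;
  cong_refl : forall S : set G, is_segment S -> cong S S;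
  cong_sym : forall S T : set G, cong S T -> cong T S;
  cong_trans : forall S T U : set G, cong S T -> cong T U -> cong S U;
  cong_layoff : forall (A B O : G) (r : set G), A <> B -> is_ray O r ->
    exists! X : G, [/\ r X, X <> O & cong (seg O X) (seg A B)];
  cong_add : forall A B C A' B' C' : G,
    between A B C -> between A' B' C' ->
    [/\ cong (seg A B) (seg A' B') -> cong (seg B C) (seg B' C') ->
          cong (seg A C) (seg A' C'),
        cong (seg A B) (seg A' B') -> cong (seg A C) (seg A' C') ->
          cong (seg B C) (seg B' C')
      & cong (seg B C) (seg B' C') -> cong (seg A C) (seg A' C') ->
          cong (seg A B) (seg A' B')];
  midpoint_exists : forall B C : G, B <> C -> exists M, is_midpoint B C M;

  axiom_T : forall (A B C A' B' : G) (l S : set G),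
    ~ collinear A B C -> cong (seg A' B') (seg A B) ->
    line l -> l A' -> l B' -> is_side l S ->
    exists C' : G, [/\ S C', cong (seg A' C') (seg A C)
                    & cong (seg B' C') (seg B C)];

  axiom_R1 : forall A B C D E F : G,
    right_angle (angle B A C) -> right_angle (angle E D F) ->
    cong (seg A B) (seg D E) -> cong (seg A C) (seg D F) ->
    cong (seg B C) (seg E F);

  (* A, B, C being arbitrary, this covers all pairs of angles of a triangle *)
  axiom_R2 : forall A B C : G, ~ collinear A B C ->
    ~ (right_angle (angle B A C) /\ right_angle (angle A B C))
}.

(* Main.v *)
Require Import Defs.
From mathcomp Require Import all_boot.
From mathcomp Require Import boolp classical_sets.

(** The only tool beyond incidence and order is a hypotenuse-leg criterion for
    right triangles, [hypotenuse_leg].  It holds because a failure would produce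
    an isosceles triangle with its base on the ray carrying one leg; its median
    is a second perpendicular from the apex to that ray, besides the other leg
    ([axiom_R1] builds the isosceles triangle, [axiom_R2] forbids the second
    perpendicular).

    Let M be the midpoint of BC, so that AM and DM are both perpendicular to BC
    because the triangles ABC and DBC are isosceles; [hypotenuse_leg] gives
    MA = MD.  The segment AD crosses the line BC at some point X, and all that
    is left is that M lies on AD, for then M = X.  Suppose it does not.
    - If X is a midpoint of AD, then MX is the median of the isosceles triangle
      MAD, so the triangle AMX has right angles at X and at M.
    - Otherwise let N be a midpoint of AD.  The same argument with the two
      diagonals exchanged gives NB = NC; now NM is the median of both isosceles
      triangles MAD and NBC, so the triangle XMN has right angles at N and at M.
    Both contradict [axiom_R2]; this is [midpoint_on_diagonal].

    Once M bisects both diagonals, each vertex is the apex of an isosceles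
    triangle on the other diagonal with foot M, and these four triangles are
    exactly the witnesses of the four pairs of consecutive right angles. *)

Local Open Scope classical_set_scope.

Set Implicit Arguments.
Unset Strict Implicit.
Unset Printing Implicit Defensive.

(** * Incidence *)

Lemma line_exists (G : geometry) (HG : plane_axioms G) (A B : G) :
  A <> B -> exists l : set G, [/\ line l, l A & l B].
Proof. by case/(line_unique HG) => l [hl _]; exists l. Qed.

Lemma line_eq (G : geometry) (HG : plane_axioms G) (A B : G) (l m : set G) :
  A <> B -> line l -> l A -> l B -> line m -> m A -> m B -> l = m.
Proof.
move=> hAB ll lA lB lm mA mB; have [k [_ hk]] := line_unique HG hAB.
by rewrite -(hk l) ?(hk m).
Qed.

Lemma lines_meet_once (G : geometry) (HG : plane_axioms G) (l m : set G)
    (X Y : G) :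
  line l -> line m -> l <> m -> l X -> m X -> l Y -> m Y -> X = Y.
Proof.
move=> ll lm hlm lX mX lY mY; apply: contrapT => hXY.
by apply: hlm; apply: (line_eq HG hXY).
Qed.

Lemma line_throughE (G : geometry) (HG : plane_axioms G) (A B : G)
    (l : set G) :
  A <> B -> line l -> l A -> l B -> line_through A B = l.
Proof.
move=> hAB ll lA lB; apply/seteqP; split=> X /=; last by exists l.
by case=> m [lm mA mB mX]; rewrite (line_eq HG hAB ll lA lB lm mA mB).
Qed.

Lemma not_collinear_off_line (G : geometry) (HG : plane_axioms G) (l : set G)
    (A B C : G) :
  A <> B -> line l -> l A -> l B -> ~ l C -> ~ collinear A B C.
Proof.
move=> hAB ll lA lB lC [m [lm mA mB mC]].
by apply: lC; rewrite (line_eq HG hAB ll lA lB lm mA mB).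
Qed.

Lemma not_collinear_apex (G : geometry) (HG : plane_axioms G) (l : set G)
    (A B C : G) :
  line l -> l B -> l C -> B <> C -> ~ l A -> ~ collinear A B C.
Proof.
move=> ll lB lC hBC lA [m [lm mA mB mC]].
by apply: lA; rewrite (line_eq HG hBC ll lB lC lm mB mC).
Qed.

(** The two distinct points cannot be dispensed with: a single point without any line
    satisfies the axioms, as the three non-collinear points are not required to
    be distinct. *)
Lemma exists_line_at (G : geometry) (HG : plane_axioms G) (P Q A : G) :
  P <> Q -> exists l : set G, line l /\ l A.
Proof.
move=> hPQ; have [hPA|hPA] := pselect (P = A).
  by have [l [ll lA _]] := line_exists HG hPQ; exists l; rewrite -hPA.
by have [l [ll _ lA]] := line_exists HG hPA; exists l.
Qed.

(** * Betweenness, segments and rays *)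

Lemma between_on_line (G : geometry) (HG : plane_axioms G) (l : set G)
    (A B C : G) :
  line l -> l A -> l B -> between A C B -> [/\ l C, C <> A & C <> B].
Proof.
move=> ll lA lB; have [le [_ _ _ _ hb]] := line_ordered HG ll.
by case/(hb A B C lA lB).
Qed.

Lemma between_sym (G : geometry) (HG : plane_axioms G) (l : set G)
    (A B C : G) :
  line l -> l A -> l B -> between A C B -> between B C A.
Proof.
move=> ll lA lB; have [le [_ _ _ _ hb]] := line_ordered HG ll.
case/(hb A B C lA lB) => lC hCA hCB h.
by apply/(hb B A C lB lA); split=> //; case: h; [right|left].
Qed.

Lemma seg_sym (G : geometry) (HG : plane_axioms G) (A B : G) :
  seg A B = seg B A.
Proof.
have [->//|hAB] := pselect (A = B).
have [l [ll lA lB]] := line_exists HG hAB.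
apply/seteqP; split=> X /= [->|->|h];
  [exact: Or32|exact: Or31|apply: Or33|exact: Or32|exact: Or31|apply: Or33].
- exact: (between_sym HG ll).
- exact: (between_sym HG ll).
Qed.

Lemma seg_on_line (G : geometry) (HG : plane_axioms G) (l : set G)
    (A B : G) :
  line l -> l A -> l B -> seg A B `<=` l.
Proof.
by move=> ll lA lB X /= [->|->|/(between_on_line HG ll lA lB)[]].
Qed.

Lemma midpoint_sym (G : geometry) (HG : plane_axioms G) (B C M : G) :
  B <> C -> is_midpoint B C M -> is_midpoint C B M.
Proof.
move=> hBC [hb hc]; have [l [ll lB lC]] := line_exists HG hBC.
by split; [exact: (between_sym HG ll)|exact: cong_sym].
Qed.

Lemma line_order_opp (G : geometry) (l : set G) (le : G -> G -> Prop) :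
  line_order l le -> line_order l (fun X Y => le Y X).
Proof.
case=> hr ha ht htot hb; split=> //.
- by move=> A B lA lB h1 h2; apply: ha.
- by move=> A B C lA lB lC h1 h2; apply: (ht C B A).
- by move=> A B lA lB; case: (htot _ _ lA lB); [right|left].
- move=> A B C lA lB; split.
    case/(hb A B C lA lB) => lC h1 h2 h.
    by split=> //; case: h => -[]; [right|left].
  case=> lC h1 h2 h; apply/(hb A B C lA lB).
  by split=> //; case: h => -[]; [right|left].
Qed.

(** A description that does not mention the order: it shows that every choice
    of an order on the line leads to the same rays. *)
Lemma half_lineE (G : geometry) (l : set G) (le : G -> G -> Prop) (O A : G) :
  line_order l le -> l O -> l A -> A <> O -> le O A ->
  [set X | l X /\ le O X] = [set X | l X /\ ~ between A O X].
Proof.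
case=> hr ha ht htot hb lO lA hAO hOA.
apply/seteqP; split=> X /= [lX hX]; split=> //.
- case/(hb A X O lA lX) => _ _ hOX [[hAO' _]|[hXO _]].
    by apply: hAO; apply: ha.
  by apply: hOX; apply: ha.
- have [hXO|hXO] := pselect (X = O); first by rewrite hXO; apply: hr.
  have [//|h] := htot _ _ lO lX.
  exfalso; apply: hX; apply/(hb A X O lA lX).
  by split=> //; [move/esym|move/esym|right].
Qed.

Lemma is_ray_half_line (G : geometry) (l : set G) (le : G -> G -> Prop)
    (O : G) :
  line l -> line_order l le -> l O -> is_ray O [set X | l X /\ le O X].
Proof.
by move=> ll hle lO; exists l, [set X | l X /\ le X O]; split=> //; exists le.
Qed.

Lemma ray_eq (G : geometry) (HG : plane_axioms G) (O A : G) (r : set G) :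
  is_ray O r -> r A -> A <> O -> ray O A = r.
Proof.
move=> hr rA hAO; apply/seteqP; split=> X /=; last by exists r.
case=> s [hs sA sX]; move: hr rA hs sA sX.
case=> l [r' [ll lO [le [hle -> _]]]] /= [lA hA].
case=> m [s' [lm mO [le' [hle' -> _]]]] /= [mA hA'].
have hlm : m = l by apply: (line_eq HG (nesym hAO)).
subst m => hX.
suff : [set X | l X /\ le O X] X by [].
by rewrite (half_lineE hle lO lA hAO hA) -(half_lineE hle' lO lA hAO hA').
Qed.

Lemma ray_order (G : geometry) (HG : plane_axioms G) (l : set G) (O A : G) :
  line l -> l O -> l A -> A <> O ->
  exists le, [/\ line_order l le, le O A & ray O A = [set X | l X /\ le O X]].
Proof.
move=> ll lO lA hAO; have [le hle] := line_ordered HG ll.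
have [_ _ _ htot _] := hle.
have [h|h] := htot _ _ lO lA.
  by exists le; split=> //; apply: ray_eq => //; apply: is_ray_half_line.
have hop := line_order_opp hle.
exists (fun X Y => le Y X); split=> //; apply: ray_eq => //.
exact: (is_ray_half_line ll hop).
Qed.

Lemma is_ray_ray (G : geometry) (HG : plane_axioms G) (O A : G) :
  A <> O -> is_ray O (ray O A).
Proof.
move=> hAO; have [l [ll lO lA]] := line_exists HG (nesym hAO).
have [le [hle _ ->]] := ray_order HG ll lO lA hAO.
exact: is_ray_half_line.
Qed.

Lemma opposite_rays_between (G : geometry) (HG : plane_axioms G) (l : set G)
    (B C M : G) (r r' : set G) :
  l B -> l C -> between B M C -> opposite_rays l M r r' ->
  (r = ray M B /\ r' = ray M C) \/ (r = ray M C /\ r' = ray M B).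
Proof.
move=> lB lC hBMC [ll lM [le [hle -> ->]]].
have [_ hMB hMC] := between_on_line HG ll lB lC hBMC.
have hr := is_ray_half_line ll hle lM.
have hr' := is_ray_half_line ll (line_order_opp hle) lM.
have [_ _ _ _ hb] := hle.
have [_ _ _ [[h1 h2]|[h1 h2]]] := (hb _ _ _ lB lC).1 hBMC.
- by right; split; apply/esym/ray_eq => //; exact: nesym.
- by left; split; apply/esym/ray_eq => //; exact: nesym.
Qed.

Lemma ray_dichotomy (G : geometry) (HG : plane_axioms G) (l : set G)
    (B C M Y : G) :
  line l -> l B -> l C -> between B M C -> l Y -> Y <> M ->
  ray M Y = ray M B \/ ray M Y = ray M C.
Proof.
move=> ll lB lC hBMC lY hYM.
have [lM _ _] := between_on_line HG ll lB lC hBMC.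
have [le [hle _ hE]] := ray_order HG ll lM lY hYM.
have hopp : opposite_rays l M (ray M Y) [set X | l X /\ le X M].
  by split=> //; exists le.
by case: (opposite_rays_between HG lB lC hBMC hopp) => -[-> _]; [left|right].
Qed.

Lemma ray_between (G : geometry) (HG : plane_axioms G) (O A A' K : G) :
  A <> O -> A' <> O -> ray O A A' -> between A K A' ->
  ray O K = ray O A /\ K <> O.
Proof.
move=> hAO hA'O; have [l [ll lO lA]] := line_exists HG (nesym hAO).
have [le [hle hA hE]] := ray_order HG ll lO lA hAO.
have hray := is_ray_ray HG hAO.
rewrite {1}hE => -[lA' hA'] hK.
have [_ ha ht _ hb] := hle.
have [lK hKA hKA' h] := (hb _ _ _ lA lA').1 hK.
have hOK : le O K.
  by case: h => -[h1 h2]; [apply: (ht O A K)|apply: (ht O A' K)].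
have hKO : K <> O.
  move=> hKO; rewrite hKO in h; case: h => -[h1 h2].
  - by apply: hAO; apply: ha.
  - by apply: hA'O; apply: ha.
by split=> //; apply: ray_eq => //; rewrite hE.
Qed.

(** * Right triangles *)

Lemma angle_sym (G : geometry) (X M Y : G) : angle X M Y = angle Y M X.
Proof. exact: setUC. Qed.

(** The point Y ranges over the whole base line because the rays from M through
    the two ends of the base cover it, and both angles of the pair are right. *)
Lemma isosceles_median_right (G : geometry) (HG : plane_axioms G) (l : set G)
    (A B C M Y : G) :
  line l -> l B -> l C -> B <> C -> ~ l A -> cong (seg A B) (seg A C) ->
  is_midpoint B C M -> l Y -> Y <> M -> right_angle (angle A M Y).
Proof.
move=> ll lB lC hBC lA hABC hM lY hYM.
have hp : paired_right_angles M (angle A M B) (angle A M C).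
  by exists A, B, C; split=> //; apply: (not_collinear_apex HG ll).
rewrite /angle; case: (ray_dichotomy HG ll lB lC hM.1 lY hYM) => ->.
- by exists M, (angle A M C); left.
- by exists M, (angle A M B); right.
Qed.

(** Lay off MA' = MD on the ray MA.  By [axiom_R1] BA' = BD = BA, so if A' were
    not A, the midpoint K of AA' would be the foot of a perpendicular from B to
    MA.  As K lies on the same ray as A, the triangle KMB would have right
    angles at K and M, against [axiom_R2]. *)
Lemma hypotenuse_leg (G : geometry) (HG : plane_axioms G) (l : set G)
    (A B D M : G) :
  line l -> l A -> l M -> A <> M -> ~ l B -> D <> M ->
  right_angle (angle A M B) -> right_angle (angle D M B) ->
  cong (seg B A) (seg B D) -> cong (seg M A) (seg M D).
Proof.
move=> ll lA lM hAM lB hDM hA hD hBAD.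
have [A' [[rA' hA'M hMA'] _]] :=
  cong_layoff HG (nesym hDM) (is_ray_ray HG hAM).
have [<-//|hA'A] := pselect (A' = A); exfalso.
have lA' : l A'.
  have [le [_ _ hE]] := ray_order HG ll lM lA hAM.
  by move: rA'; rewrite hE => -[].
have hBM : B <> M by move=> h; apply: lB; rewrite h.
have hA' : right_angle (angle A' M B).
  by rewrite /angle (ray_eq HG (is_ray_ray HG hAM) rA' hA'M).
have hMB : cong (seg M B) (seg M B).
  by apply: (cong_refl HG); exists M, B; split=> // /esym.
have hBA' : cong (seg B A) (seg B A').
  apply: (cong_trans HG hBAD); apply: (cong_sym HG).
  by rewrite (seg_sym HG B A') (seg_sym HG B D); apply: (axiom_R1 HG hA' hD).
have [K hK] := midpoint_exists HG (nesym hA'A).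
have [lK _ _] := between_on_line HG ll lA lA' hK.1.
have [rK hKM] := ray_between HG hAM hA'M rA' hK.1.
have hKMB : ~ collinear K M B by apply: (not_collinear_off_line HG hKM ll).
apply: (axiom_R2 HG hKMB); split; last by rewrite /angle rK.
rewrite angle_sym.
exact: (isosceles_median_right HG ll lA lA' (nesym hA'A) lB hBA' hK lM (nesym hKM)).
Qed.

(** * The rhombus *)

(** If M were not on AD, the median from M in the isosceles triangle MAD would
    be perpendicular to AD, and M, the crossing point X and either A or the
    midpoint N of AD would span a triangle with two right angles.  The case
    split on X being a midpoint of AD keeps N off the line BC, where it could
    only be X. *)
Lemma midpoint_on_diagonal (G : geometry) (HG : plane_axioms G) (l m : set G)
    (A B C D M X : G) :
  line l -> l B -> l C -> B <> C -> ~ l A -> ~ l D ->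
  line m -> m A -> m D -> A <> D -> between A X D -> l X ->
  cong (seg A B) (seg A C) -> cong (seg D B) (seg D C) ->
  cong (seg B A) (seg B D) -> cong (seg C A) (seg C D) ->
  is_midpoint B C M -> m M /\ cong (seg M A) (seg M D).
Proof.
move=> ll lB lC hBC lA lD lm mA mD hAD hX lX hA hD hB hC hM.
have [mX _ _] := between_on_line HG lm mA mD hX.
have [lM hMB hMC] := between_on_line HG ll lB lC hM.1.
have hAM : A <> M by move=> h; apply: lA; rewrite h.
have hDM : D <> M by move=> h; apply: lD; rewrite h.
have AMr Y : l Y -> Y <> M -> right_angle (angle A M Y).
  by apply: (isosceles_median_right HG ll lB lC).
have hMAD : cong (seg M A) (seg M D).
  have [k [lk kA kM]] := line_exists HG hAM.
  apply: (hypotenuse_leg (B := B) HG lk) => //.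
  - move=> kB; apply: lA.
    by rewrite -(line_eq HG hMB lk kM kB ll lM lB).
  - exact/AMr/nesym.
  - apply: (isosceles_median_right HG ll lB lC hBC lD hD hM lB); exact: nesym.
split=> //; apply: contrapT => mM.
have hXM : X <> M by move=> h; apply: mM; rewrite -h.
have [hXmid|hXmid] := pselect (cong (seg X A) (seg X D)).
  (* In the triangle AMX, AM is the median of ABC and MX that of MAD. *)
  have hAX : A <> X by move=> h; apply: lA; rewrite h.
  have hnc : ~ collinear M X A.
    by apply: (not_collinear_off_line HG (nesym hXM) ll).
  apply: (axiom_R2 HG hnc); split; first by rewrite angle_sym; apply: AMr.
  exact: (isosceles_median_right HG lm mA mD hAD mM hMAD (conj hX hXmid) mA hAX).
have [N hN] := midpoint_exists HG hAD.
have [mN hNA hND] := between_on_line HG lm mA mD hN.1.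
have hlm : l <> m by move=> h; apply: lA; rewrite h.
have hNX : N <> X by move=> h; apply: hXmid; rewrite -h; exact: hN.2.
have lN : ~ l N.
  by move=> lN; apply: hNX; apply: (lines_meet_once HG ll lm).
(* Such a P on AD would be X, which would then bisect AD. *)
have mP P : l P -> cong (seg P A) (seg P D) -> ~ m P.
  move=> lP hP mP; apply: hXmid.
  by rewrite (lines_meet_once HG ll lm hlm lX mX lP mP).
have Nr P Y : l P -> cong (seg P A) (seg P D) -> m Y -> Y <> N ->
    right_angle (angle P N Y).
  by move=> lP hP; apply: (isosceles_median_right HG lm mA mD hAD (mP _ lP hP) hP hN).
have hBN : B <> N by move=> h; apply: lN; rewrite -h.
have hCN : C <> N by move=> h; apply: lN; rewrite -h.
have hNBC : cong (seg N B) (seg N C).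
  have [k [lk kB kN]] := line_exists HG hBN.
  apply: (hypotenuse_leg (B := A) HG lk) => //.
  - move=> kA; apply: (mP _ lB hB).
    by rewrite -(line_eq HG hNA lk kN kA lm mN mA).
  - exact/Nr/nesym.
  - exact/Nr/nesym.
(* In the triangle XMN, NM is the median of both NBC and MAD. *)
have hnc := not_collinear_apex HG lm mN mX hNX mM.
apply: (axiom_R2 HG hnc); split.
  exact: (isosceles_median_right HG ll lB lC hBC lN hNBC hM lX hXM).
exact: (Nr _ _ lM hMAD mX (nesym hNX)).
Qed.

(** Going round M, the apexes of the four isosceles triangles with median at M
    are A, C, D and B.  The statement is invariant under exchanging B with C or
    A with D, which handles every naming of the four rays. *)
Lemma bisecting_rays_paired (G : geometry) (HG : plane_axioms G) (l m : set G)
    (A B C D M : G) :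
  line l -> l B -> l C -> B <> C -> line m -> m A -> m D -> A <> D ->
  ~ l A -> ~ l D -> ~ m B -> ~ m C ->
  cong (seg A B) (seg A C) -> cong (seg D B) (seg D C) ->
  cong (seg B A) (seg B D) -> cong (seg C A) (seg C D) ->
  is_midpoint B C M -> is_midpoint A D M ->
  [/\ paired_right_angles M [set ray M B; ray M A] [set ray M A; ray M C],
      paired_right_angles M [set ray M A; ray M C] [set ray M C; ray M D],
      paired_right_angles M [set ray M C; ray M D] [set ray M D; ray M B]
    & paired_right_angles M [set ray M D; ray M B] [set ray M B; ray M A]].
Proof.
move=> ll lB lC hBC lm mA mD hAD lA lD mB mC hA hD hB hC hM hM'.
split.
- by exists A, B, C; split=> //; [apply: (not_collinear_apex HG ll)|exact: setUC].
- by exists C, A, D; split=> //; [apply: (not_collinear_apex HG lm)|exact: setUC].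
- exists D, C, B; split=> //; [|exact: cong_sym|exact: midpoint_sym|exact: setUC].
  by apply: (not_collinear_apex HG ll) => //; exact: nesym.
- exists B, D, A; split=> //; [|exact: cong_sym|exact: midpoint_sym|exact: setUC].
  by apply: (not_collinear_apex HG lm) => //; exact: nesym.
Qed.

Theorem theorem2 (G : geometry) (HG : plane_axioms G) (A B C D : G)
    (hABDC : rhombus A B D C) :
  (forall M : G, is_midpoint B C M ->
     is_midpoint A D M /\ seg B C `&` seg A D = [set M]) /\
  perpendicular (line_through B C) (line_through A D).
Proof.
case: hABDC => hABC hsides hABBD hBDDC hDCCA.
have [S [S' [hS SA SD]]] := hsides.
have hAD : A <> D.
  move=> h; have [_ h0 _ _ _] := hS.
  by suff : set0 A by []; rewrite -h0; split=> //; rewrite h.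
have hBC : B <> C.
  move=> h; apply: hABC; rewrite -h; have [hAB|hAB] := pselect (A = B).
    have [l [ll lA]] := exists_line_at HG A hAD.
    by exists l; rewrite -hAB.
  by have [l [ll lA lB]] := line_exists HG hAB; exists l.
have [l [ll lB lC]] := line_exists HG hBC.
have [m [lm mA mD]] := line_exists HG hAD.
rewrite (line_throughE HG hBC ll lB lC) in hS *.
rewrite (line_throughE HG hAD lm mA mD).
case: hS => _ _ hU _ hmeet.
have lA : ~ l A by have : (~` l) A by rewrite -hU; left.
have lD : ~ l D by have : (~` l) D by rewrite -hU; right.
have [X [hX lX]] := hmeet _ _ SA SD.
have hAXD : between A X D by case: hX => [hX|hX|//]; subst X.
have [mX _ _] := between_on_line HG lm mA mD hAXD.
have hlm : l <> m by move=> h; apply: lA; rewrite h.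
have ctr := cong_trans HG; have csy := cong_sym HG.
have hB : cong (seg B A) (seg B D) by rewrite (seg_sym HG B A).
have hD : cong (seg D B) (seg D C) by rewrite (seg_sym HG D B).
have hC : cong (seg C A) (seg C D).
  by rewrite (seg_sym HG C D); apply: csy.
have hA : cong (seg A B) (seg A C).
  by rewrite (seg_sym HG A C); apply: (ctr _ _ _ hABBD); apply: (ctr _ _ _ hBDDC).
have bisect M : is_midpoint B C M -> is_midpoint A D M /\ m M.
  move=> hM.
  have [mM hMAD] := midpoint_on_diagonal HG ll lB lC hBC lA lD lm mA mD hAD hAXD
    lX hA hD hB hC hM.
  have [lM _ _] := between_on_line HG ll lB lC hM.1.
  have hXM : X = M by apply: (lines_meet_once HG ll lm).
  by split=> //; split=> //; rewrite -hXM.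
split.
  move=> M hM; have [hM' mM] := bisect M hM; split=> //.
  have [lM _ _] := between_on_line HG ll lB lC hM.1.
  apply/seteqP; split=> Y /=.
    case=> /(seg_on_line HG ll lB lC) lY /(seg_on_line HG lm mA mD) mY.
    exact: (lines_meet_once HG ll lm).
  by move=> ->; split; apply: Or33; [exact: hM.1|exact: hM'.1].
have [M hM] := midpoint_exists HG hBC.
have [hM' mM] := bisect M hM.
have [lM hMB hMC] := between_on_line HG ll lB lC hM.1.
have mB : ~ m B.
  by move=> mB; apply: hMB; apply: (lines_meet_once HG ll lm).
have mC : ~ m C.
  by move=> mC; apply: hMC; apply: (lines_meet_once HG ll lm).
split=> //; exists M; split=> // r r' s s' hr hs.
have hMs := midpoint_sym HG hBC hM; have hMs' := midpoint_sym HG hAD hM'.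
have hCB := nesym hBC; have hDA := nesym hAD.
case: (opposite_rays_between HG lB lC hM.1 hr) => -[-> ->];
  case: (opposite_rays_between HG mA mD hM'.1 hs) => -[-> ->].
all: by apply: (bisecting_rays_paired HG (l := l) (m := m)) => //; exact: csy.
Qed.
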